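(* Let $x^0\in\mathbb{R}^n$ and let $S=[s^1\ \cdots\ s^n]\in\mathbb{R}^{n\times n}$ have full rank. Select $\ell\in\{0,1,\dots,n\}$ and set $\overline{T}:=U_\ell$, where $U_0=S$ and, for $\ell\in\{1,\dots,n\}$, $$U_\ell=[\,s^1-s^\ell\ \cdots\ s^{\ell-1}-s^\ell\ \ -s^\ell\ \ s^{\ell+1}-s^\ell\ \cdots\ s^n-s^\ell\,]\in\mathbb{R}^{n\times n}.$$ Then the set $\mathcal{M}(x^0;S,\overline{T})$ is poised for quadratic interpolation.
   Context: For $S=[s^1\cdots s^n]$ and $\overline{T}=U_\ell=[t^1\cdots t^n]$, $\mathcal{M}(x^0;S,\overline{T})$ denotes the set of all distinct points at which the function is evaluated when computing the generalized simplex Hessian at $x^0$ over $S$ and $\overline{T}$, that is, $$\mathcal{M}(x^0;S,\overline{T})=\{x^0\}\cup\{x^0+s^i\}_i\cup\{x^0+t^j\}_j\cup\{x^0+s^i+t^j\}_{i,j},\quad i,j\in\{1,\dots,n\}.$$ A set of distinct points $\{y^0,y^1,\dots,y^p\}\subset\mathbb{R}^n$ with $p=\frac12(n+1)(n+2)-1$ is poised for quadratic interpolation if the system $$\alpha_0+\alpha^\top y^i+\tfrac12 (y^i)^\top \mathbf{H}\,y^i=0,\quad i\in\{0,1,\dots,p\},$$ has a unique solution in $\alpha_0\in\mathbb{R}$, $\alpha\in\mathbb{R}^n$, $\mathbf{H}=\mathbf{H}^\top\in\mathbb{R}^{n\times n}$. *)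

(* Defs.v *)
From mathcomp Require Import all_boot all_order all_algebra.
From mathcomp Require Import boolp classical_sets reals.

Set Implicit Arguments.
Unset Strict Implicit.
Unset Printing Implicit Defensive.

Import GRing.Theory Num.Theory.

Local Open Scope classical_set_scope.
Local Open Scope ring_scope.

(* The columns of S are s^1, ..., s^n, so the paper's s^k is [col i S] with
   [val i = k - 1].  For l : 'I_n.+1, [unlift ord0 l] is [None] when l = 0 and
   [Some k] with [val k = l - 1] otherwise, so that [col k S] is then s^l. *)
Definition Umx (R : realType) (n : nat) (S : 'M[R]_n) (l : 'I_n.+1) : 'M[R]_n :=
  if unlift ord0 l is Some k then
    \matrix_(i, j) (if j == k then - S i k else S i j - S i k)
  else S.

Definition eval_points (R : realType) (n : nat) (x0 : 'cV[R]_n)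
    (S T : 'M[R]_n) : set 'cV[R]_n :=
  [set x0]
  `|` [set x0 + col i S | i in [set: 'I_n]]
  `|` [set x0 + col j T | j in [set: 'I_n]]
  `|` [set x0 + col i S + col j T | i in [set: 'I_n] & j in [set: 'I_n]].

Definition quad_val (R : realType) (n : nat) (a0 : R) (a : 'cV[R]_n)
    (H : 'M[R]_n) (y : 'cV[R]_n) : R :=
  a0 + (a^T *m y) 0 0 + 2^-1 * (y^T *m H *m y) 0 0.

Definition last_index (n : nat) : nat := (((n + 1) * (n + 2))./2 - 1)%N.

(* Uniqueness refers to the whole triple (a0, a, H) with H symmetric.  The
   injective enumeration forces Y to have exactly (n+1)(n+2)/2 elements. *)
Definition quad_poised (R : realType) (n : nat) (Y : set 'cV[R]_n) : Prop :=
  exists y : 'I_(last_index n).+1 -> 'cV[R]_n,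
    [/\ injective y,
        Y = range y
      & exists! c : R * 'cV[R]_n * 'M[R]_n,
          c.2^T = c.2 /\ forall i, quad_val c.1.1 c.1.2 c.2 (y i) = 0].

(* Main.v *)
(** Put s^0 = 0.  Together with 0, the columns of U_l are exactly the
    differences s^b - s^l, so that the evaluation set is
    { (x^0 - s^l) + s^a + s^b : 0 <= a <= b <= n } for every l.  Since
    s^1, ..., s^n is a basis, these (n+1)(n+2)/2 points are distinct.  If a
    quadratic vanishes on all of them, its second differences in the directions
    s^i, s^j vanish, which kills H; then its first differences kill alpha, and
    finally alpha_0 = 0. *)
Require Import Defs.
From mathcomp Require Import all_boot all_order all_algebra.
From mathcomp Require Import boolp classical_sets reals.
From mathcomp Require Import zify ring.

Set Implicit Arguments.
Unset Strict Implicit.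
Unset Printing Implicit Defensive.

Import GRing.Theory Num.Theory.

Local Open Scope ring_scope.

(* The vector s^a, with s^0 = 0. *)
Definition vertex (R : realType) (n : nat) (S : 'M[R]_n) (a : 'I_n.+1) :
    'cV[R]_n :=
  S *m \col_k (lift ord0 k == a)%:R.

Lemma vertex0 (R : realType) (n : nat) (S : 'M[R]_n) : vertex S ord0 = 0.
Proof.
rewrite /vertex (_ : \col_k _ = 0) ?mulmx0 //.
by apply/colP => k; rewrite !mxE -val_eqE.
Qed.

Lemma vertex_lift (R : realType) (n : nat) (S : 'M[R]_n) (k : 'I_n) :
  vertex S (lift ord0 k) = col k S.
Proof.
rewrite colE /vertex; congr (_ *m _).
by apply/colP => i; rewrite !mxE (inj_eq lift_inj) eqxx andbT.
Qed.

(** The column -s^l of U_l is s^0 - s^l, so the index [l] is traded for 0 in that position. For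
    [l = 0] the trade never happens, since lifted indices are nonzero. *)
Lemma col_Umx (R : realType) (n : nat) (S : 'M[R]_n) (l : 'I_n.+1) (j : 'I_n) :
  col j (Umx S l) =
  vertex S (if lift ord0 j == l then ord0 else lift ord0 j) - vertex S l.
Proof.
rewrite /Umx; case: unliftP => [k|] ->.
  rewrite (inj_eq lift_inj) (fun_if (vertex S)) vertex0 !vertex_lift.
  by apply/colP => i; rewrite !mxE; case: eqP => _; rewrite !mxE ?sub0r.
by rewrite -val_eqE /= vertex_lift vertex0 subr0.
Qed.

(** The index [a] records the shift by a column of [S], and [b] the shift by a column of U_l;
    [a = 0] and [b = l] stand for no shift. *)
Lemma eval_points_vertex (R : realType) (n : nat) (x0 : 'cV[R]_n)
    (S : 'M[R]_n) (l : 'I_n.+1) :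
  eval_points x0 S (Umx S l) =
  [set y | exists a b, y = x0 - vertex S l + (vertex S a + vertex S b)]%classic.
Proof.
have shift (u v w : 'cV[R]_n) : x0 - w + (u + v) = x0 + u + (v - w).
  by rewrite addrACA (addrC (- w)).
apply/seteqP; split => y /=.
- case=> [[[->|[i _ <-]]|[j _ <-]]|[i _ [j _ <-]]].
  + by exists ord0, l; rewrite shift vertex0 subrr !addr0.
  + by exists (lift ord0 i), l; rewrite shift vertex_lift subrr addr0.
  + exists ord0; eexists; rewrite shift vertex0 addr0 col_Umx; reflexivity.
  + by exists (lift ord0 i); eexists; rewrite shift vertex_lift col_Umx.
- case=> a [b ->]; rewrite shift.
  have [->|neq_bl] := eqVneq b l.
    rewrite subrr addr0; left; left.
    case: (unliftP ord0 a) => [i|] ->; last by left; rewrite vertex0 addr0.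
    by right; exists i; rewrite // vertex_lift.
  (* For b > 0 this is the column in position b; b = 0 forces l > 0, and then it is the column in
     position l. *)
  have [j ->] : exists j, vertex S b - vertex S l = col j (Umx S l).
    case: (unliftP ord0 b) => [j eq_b|eq_b].
      by exists j; rewrite col_Umx -eq_b (negPf neq_bl).
    case: (unliftP ord0 l) => [k eq_l|eq_l].
      by exists k; rewrite col_Umx -eq_l eqxx eq_b.
    by rewrite eq_b eq_l eqxx in neq_bl.
  case: (unliftP ord0 a) => [i|] ->.
    by right; exists i => //; exists j; rewrite // vertex_lift.
  by left; right; exists j; rewrite // vertex0 addr0.
Qed.

(** Cancelling [S] leaves vectors whose coordinates count the occurrences of each nonzero index in
    the pair. These counts determine the larger entry, then the smaller one. *)
Lemma vertexD_inj (R : realType) (n : nat) (S : 'M[R]_n)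
    (a b c d : 'I_n.+1) :
  S \in unitmx -> (a <= b)%N -> (c <= d)%N ->
  vertex S a + vertex S b = vertex S c + vertex S d -> a = c /\ b = d.
Proof.
move=> unitS le_ab le_cd; rewrite /vertex -!mulmxDr => /(can_inj (mulKmx unitS)).
move=> /colP eq_col.
(* Index 0 has no coordinate, hence the condition 0 < i. The counts are compared in [R], whose
   characteristic is 0. *)
have eq_count (i : 'I_n.+1) : (0 < i)%N ->
    ((val i == val a) + (val i == val b) =
     (val i == val c) + (val i == val d))%N.
  case: (unliftP ord0 i) => [k|] -> // _; apply/eqP.
  by rewrite -(@eqr_nat R) !natrD !val_eqE; have := eq_col k; rewrite !mxE => ->.
(* If b < d, then d is positive and occurs in (c, d), but not in (a, b) because a <= b < d. The
   other case is symmetric. *)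
have eq_bd : val b = val d.
  case: (ltngtP (val b) (val d)) => // lt_bd.
  - have := eq_count d (leq_ltn_trans (leq0n _) lt_bd).
    by rewrite eqxx (gtn_eqF lt_bd) (gtn_eqF (leq_ltn_trans le_ab lt_bd)) addn1.
  - have := eq_count b (leq_ltn_trans (leq0n _) lt_bd).
    by rewrite eqxx (gtn_eqF lt_bd) (gtn_eqF (leq_ltn_trans le_cd lt_bd)) addn1.
split; last exact: val_inj.
apply: val_inj; case: (ltngtP (val a) (val c)) => // lt_ac.
- have := eq_count c (leq_ltn_trans (leq0n _) lt_ac).
  by rewrite eq_bd => /addIn; rewrite eqxx (gtn_eqF lt_ac).
- have := eq_count a (leq_ltn_trans (leq0n _) lt_ac).
  by rewrite eq_bd => /addIn; rewrite eqxx (gtn_eqF lt_ac).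
Qed.

(** Constant and linear terms cancel; symmetry of [H] merges the cross terms u^T H v and v^T H u,
    which absorbs the factor 1/2. *)
Lemma quad_val_second_difference (R : realType) (n : nat) (a0 : R)
    (a : 'cV[R]_n) (H : 'M[R]_n) (z u v : 'cV[R]_n) : H^T = H ->
  quad_val a0 a H (z + (u + v)) - quad_val a0 a H (z + u)
    - quad_val a0 a H (z + v) + quad_val a0 a H z = (u^T *m H *m v) 0 0.
Proof.
move=> symH.
have symB (p q : 'cV[R]_n) : (q^T *m H *m p) 0 0 = (p^T *m H *m q) 0 0.
  transitivity ((p^T *m H *m q)^T 0 0); last by rewrite mxE.
  by rewrite !trmx_mul trmxK symH mulmxA.
rewrite /quad_val !linearD /= !mulmxDl.
do ![rewrite [((_ + _)%R : 'M__) _ _]mxE].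
rewrite (symB u z) (symB v z) (symB u v); by field.
Qed.

Lemma quad_val_unisolvent (R : realType) (n : nat) (a0 : R) (a : 'cV[R]_n)
    (S H : 'M[R]_n) (z : 'cV[R]_n) :
  S \in unitmx -> H^T = H ->
  (forall i j, quad_val a0 a H (z + (vertex S i + vertex S j)) = 0) ->
  [/\ a0 = 0, a = 0 & H = 0].
Proof.
move=> unitS symH q0.
have qz : quad_val a0 a H z = 0.
  by have := q0 ord0 ord0; rewrite vertex0 !addr0.
have qc i : quad_val a0 a H (z + col i S) = 0.
  by have := q0 (lift ord0 i) ord0; rewrite vertex0 addr0 vertex_lift.
have H0 : H = 0.
  (* The entries of S^T H S are second differences at [z]; the invertible factors are then cancelled
     on both sides. *)
  have : S^T *m H *m S = 0.
    apply/matrixP => i j; rewrite [RHS]mxE.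
    have := quad_val_second_difference a0 a z (col i S) (col j S) symH.
    have := q0 (lift ord0 i) (lift ord0 j); rewrite !vertex_lift => ->.
    rewrite !qc qz !subr0 addr0 => zeroE; rewrite [RHS]zeroE.
    by rewrite tr_col -row_mul !mxE; apply: eq_bigr => k _; rewrite !mxE.
  move=> /(congr1 (mulmx^~ (invmx S))); rewrite mul0mx mulmxK // => SH0.
  by rewrite -[H](mulKmx (_ : S^T \in unitmx)) ?unitmx_tr // SH0 mulmx0.
have qE y : quad_val a0 a H y = a0 + (a^T *m y) 0 0.
  by rewrite /quad_val H0 mulmx0 mul0mx [(0 : 'M__) _ _]mxE mulr0 addr0.
have aT0 : a^T = 0.
  suff : a^T *m S = 0.
    by move=> /(congr1 (mulmx^~ (invmx S))); rewrite mul0mx mulmxK.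
  apply/rowP => i; rewrite [RHS]mxE.
  have := qc i; rewrite qE mulmxDr [((_ + _)%R : 'M__) _ _]mxE addrA -qE qz add0r.
  by rewrite colE mulmxA -colE mxE.
split=> //; first by move: qz; rewrite qE aT0 mul0mx mxE addr0.
by rewrite -[a]trmxK aT0 trmx0.
Qed.

(** Swapping two indices gives the same point, so each unordered pair, repetition allowed, is
    represented by its nondecreasing tuple. *)
Definition sorted_pairs (n : nat) : {set 2.-tuple 'I_n.+1} :=
  [set t : 2.-tuple 'I_n.+1 | sorted leq (map val t)].

Lemma sorted_pairsE (n : nat) (t : 2.-tuple 'I_n.+1) :
  (t \in sorted_pairs n) = (tnth t ord0 <= tnth t ord_max)%N.
Proof.
rewrite inE; case/tupleP: t => a t; case/tupleP: t => b t.
by rewrite (tuple0 t) /= andbT.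
Qed.

(** Multisets of size 2 on n + 1 indices number binomial(n + 2, 2). This is positive, so the
    successor undoes the truncated subtraction in [last_index]. *)
Lemma card_sorted_pairs (n : nat) : #|sorted_pairs n| = (last_index n).+1.
Proof.
rewrite card_sorted_tuples bin2 /last_index /= !(addn1, addn2, add2n) mulnC.
by rewrite subn1 prednK // half_gt0 mulSn; lia.
Qed.

Theorem proposition5p7 (R : realType) (n : nat) (x0 : 'cV[R]_n) (S : 'M[R]_n)
    (hS : \rank S = n) (l : 'I_n.+1) :
  quad_poised (eval_points x0 S (Umx S l)).
Proof.
have unitS : S \in unitmx by rewrite -row_full_unit /row_full hS.
rewrite eval_points_vertex; set z := x0 - _.
pose f (t : 2.-tuple 'I_n.+1) :=
  z + (vertex S (tnth t ord0) + vertex S (tnth t ord_max)).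
pose e i := enum_val (cast_ord (esym (card_sorted_pairs n)) i).
have e_sorted i : (tnth (e i) ord0 <= tnth (e i) ord_max)%N.
  by rewrite -sorted_pairsE enum_valP.
have e_onto a b : exists i,
    f (e i) = z + (vertex S a + vertex S b).
  wlog le_ab : a b / (a <= b)%N => [base|].
    have [/base//|/ltnW/base[i eq_i]] := leqP a b.
    by exists i; rewrite eq_i (addrC (vertex S b)).
  have ab_sorted : [tuple a; b] \in sorted_pairs n by rewrite sorted_pairsE.
  exists (cast_ord (card_sorted_pairs n) (enum_rank_in ab_sorted [tuple a; b])).
  by rewrite /e cast_ordK enum_rankK_in.
exists (f \o e); split.
- move=> i j /addrI /(vertexD_inj unitS (e_sorted i) (e_sorted j)) [eq0 eq1].
  apply/(@cast_ord_inj _ _ (esym (card_sorted_pairs n)))/enum_val_inj.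
  apply: eq_from_tnth => k; rewrite -/(e i) -/(e j).
  by case: k => [[|[|//]] lt_k2]; [move: eq0|move: eq1];
     rewrite !(tnth_nth ord0).
- apply/seteqP; split => y /=.
    by case=> a [b ->]; have [i <-] := e_onto a b; exists i.
  by case=> i _ <-; eexists; eexists; reflexivity.
(* The zero quadratic is a solution. It is the only one, because the enumeration reaches the point
   of every ordered pair of indices. *)
- exists (0, 0, 0); split=> [|[[a0 a] H] /= [symH q0]].
    split=> [|i]; first by rewrite trmx0.
    by rewrite /quad_val /= trmx0 mulmx0 !mul0mx !mxE mulr0 !addr0.
  have [|-> -> ->//] := @quad_val_unisolvent R n a0 a S H z unitS symH.
  by move=> a' b'; have [i <-] := e_onto a' b'; apply: q0.
Qed.
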